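(* There exists a group $G$ that is generated by $2$ elements, is elementary amenable, and is mixed identity-free (MIF).
   Context: For a group $G$ and a free group $F$ (on a basis $\{x,y,\ldots\}$), let $G \ast F$ be the free product. The group $G$ satisfies the mixed identity $w=1$, where $w \in G \ast F$, if for every homomorphism $\varepsilon : G \ast F \to G$ that restricts to the identity on $G$ one has $\varepsilon(w)=1$. The mixed identity $w=1$ is nontrivial if $w$ is a nontrivial element of $G \ast F$. The group $G$ is mixed identity-free (MIF) if it satisfies no nontrivial mixed identity; i.e. for every $n \in \mathbb{N}$ and every nontrivial $w \in G \ast F_n$ ($F_n$ free of rank $n$) there is a homomorphism $\varphi : G \ast F_n \to G$ that is the identity on $G$ and satisfies $\varphi(w) \neq 1$. The class of elementary amenable groups is the smallest class of groups containing all finite groups and all abelian groups and closed under taking subgroups, quotients, extensions, and directed unions. *)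

(* Defs.v *)
From HB Require Import structures.
From mathcomp Require Import all_boot.
From mathcomp Require Import boolp classical_sets.

Set Implicit Arguments.
Unset Strict Implicit.
Unset Printing Implicit Defensive.

Local Open Scope quotient_scope.
Local Open Scope group_scope.
Local Open Scope classical_set_scope.

(* On groupTypes these are the group homomorphisms. *)
Notation "{ 'hom' G '->' H }" := (UMagmaMorphism.type G%type H%type)
  (at level 0, G at level 98, H at level 99,
   format "{ 'hom'  G  ->  H }") : type_scope.

(******************************************************************************)
(* Group presentations <X | R>. A word is a sequence of letters (x, b), where *)
(* (x, true) stands for x and (x, false) for x^-1; R relates the two sides of *)
(* the defining relations.                                                    *)
(******************************************************************************)

Definition word (X : Type) := seq (X * bool).

Definition letterV (X : Type) (a : X * bool) : X * bool := (a.1, ~~ a.2).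

Definition wordV (X : Type) (u : word X) : word X := rev (map (@letterV X) u).

Inductive word_eq (X : Type) (R : word X -> word X -> Prop) :
    word X -> word X -> Prop :=
| WordEqRel u v p q : R u v -> word_eq R (p ++ u ++ q) (p ++ v ++ q)
| WordEqCancel a p q : word_eq R (p ++ [:: a; letterV a] ++ q) (p ++ q)
| WordEqRefl u : word_eq R u u
| WordEqSym u v : word_eq R u v -> word_eq R v u
| WordEqTrans u v w : word_eq R u v -> word_eq R v w -> word_eq R u w.

Section Presentation.
Variables (X : choiceType) (R : word X -> word X -> Prop).

Definition word_eqb : rel (word X) := fun u v => `[< word_eq R u v >].

Lemma word_eqb_refl : reflexive word_eqb.
Proof. by move=> u; apply/asboolP; exact: WordEqRefl. Qed.

Lemma word_eqb_sym : symmetric word_eqb.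
Proof. by move=> u v; apply/asboolP/asboolP; exact: WordEqSym. Qed.

Lemma word_eqb_trans : transitive word_eqb.
Proof.
by move=> v u w /asboolP uv /asboolP vw; apply/asboolP; exact: WordEqTrans vw.
Qed.

Canonical word_equiv :=
  EquivRel word_eqb word_eqb_refl word_eqb_sym word_eqb_trans.

Definition presented := {eq_quot word_equiv}.

HB.instance Definition _ := EqQuotient.on presented.
HB.instance Definition _ := Choice.on presented.

Definition word_class (u : word X) : presented := \pi_presented u.

Lemma word_classP u v : word_class u = word_class v <-> word_eq R u v.
Proof.
have e : (word_class u == word_class v) = word_eqb u v by exact: eqmodE.
split=> [/eqP|uv]; first by rewrite e => /asboolP.
by apply/eqP; rewrite e; apply/asboolP.
Qed.

Lemma word_classK (x : presented) : word_class (repr x) = x.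
Proof. exact: reprK. Qed.

Lemma word_eq_cat u u' v v' :
  word_eq R u u' -> word_eq R v v' -> word_eq R (u ++ v) (u' ++ v').
Proof.
move=> uu' vv'; apply: (@WordEqTrans _ _ _ (u' ++ v)).
  elim: uu' => {u u'} [u u' p q r|a p q|u|u u' _|u u' u'' _ h _].
  - by rewrite -!catA; exact: WordEqRel.
  - by rewrite -!catA; exact: WordEqCancel.
  - exact: WordEqRefl.
  - exact: WordEqSym.
  - exact: WordEqTrans h.
elim: vv' => {v v'} [v v' p q r|a p q|v|v v' _|v v' v'' _ h _].
- by rewrite !(catA u' p); exact: WordEqRel.
- by rewrite !(catA u' p); exact: WordEqCancel.
- exact: WordEqRefl.
- exact: WordEqSym.
- exact: WordEqTrans h.
Qed.

Lemma letterVK : involutive (@letterV X).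
Proof. by case=> x b; rewrite /letterV /= negbK. Qed.

Lemma wordVK : involutive (@wordV X).
Proof. by move=> u; rewrite /wordV map_rev revK mapK //; exact: letterVK. Qed.

Lemma word_eqVr u : word_eq R (u ++ wordV u) [::].
Proof.
elim: u => [|a u IH]; first exact: WordEqRefl.
rewrite /wordV map_cons rev_cons -cats1 -/(wordV u) /= -cat1s catA.
apply: (@WordEqTrans _ _ _ ([:: a] ++ [::] ++ [:: letterV a])); last first.
  exact: (@WordEqCancel _ _ a [::] [::]).
rewrite -!catA catA -!catA; apply: word_eq_cat; first exact: WordEqRefl.
by rewrite catA; apply: word_eq_cat => //; exact: WordEqRefl.
Qed.

Lemma word_eqVl u : word_eq R (wordV u ++ u) [::].
Proof. by rewrite -{2}(wordVK u); exact: word_eqVr. Qed.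

Lemma word_eqV u v : word_eq R u v -> word_eq R (wordV u) (wordV v).
Proof.
move=> uv; apply: (@WordEqTrans _ _ _ (wordV u ++ v ++ wordV v)).
  rewrite -{1}(cats0 (wordV u)); apply: word_eq_cat; first exact: WordEqRefl.
  by apply: WordEqSym; exact: word_eqVr.
rewrite catA -[X in word_eq R _ X]cat0s; apply: word_eq_cat (WordEqRefl _ _).
apply: WordEqTrans (word_eqVl u); apply: word_eq_cat (WordEqSym uv).
exact: WordEqRefl.
Qed.

Definition pres_one : presented := word_class [::].
Definition pres_mul (x y : presented) : presented :=
  word_class (repr x ++ repr y).
Definition pres_inv (x : presented) : presented := word_class (wordV (repr x)).

Lemma word_eq_repr u : word_eq R (repr (word_class u)) u.
Proof. by apply/word_classP; rewrite word_classK. Qed.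

Lemma pres_mulE u v :
  pres_mul (word_class u) (word_class v) = word_class (u ++ v).
Proof. by apply/word_classP; apply: word_eq_cat; exact: word_eq_repr. Qed.

Lemma pres_invE u : pres_inv (word_class u) = word_class (wordV u).
Proof. by apply/word_classP; apply: word_eqV; exact: word_eq_repr. Qed.

Lemma pres_mulA : associative pres_mul.
Proof.
move=> x y z; rewrite -(word_classK x) -(word_classK y) -(word_classK z).
by rewrite !pres_mulE catA.
Qed.

Lemma pres_mul1g : left_id pres_one pres_mul.
Proof. by move=> x; rewrite -(word_classK x) pres_mulE. Qed.

Lemma pres_mulg1 : right_id pres_one pres_mul.
Proof. by move=> x; rewrite -(word_classK x) pres_mulE cats0. Qed.

Lemma pres_mulVg : left_inverse pres_one pres_inv pres_mul.
Proof.
move=> x; rewrite -(word_classK x) pres_invE pres_mulE.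
exact/word_classP/word_eqVl.
Qed.

Lemma pres_mulgV : right_inverse pres_one pres_inv pres_mul.
Proof.
move=> x; rewrite -(word_classK x) pres_invE pres_mulE.
exact/word_classP/word_eqVr.
Qed.

HB.instance Definition _ := isGroup.Build presented
  pres_mulA pres_mul1g pres_mulg1 pres_mulVg pres_mulgV.

Definition pres_gen (x : X) : presented := word_class [:: (x, true)].

Lemma word_class1 : word_class [::] = 1.
Proof. by []. Qed.

Lemma word_classM u v : word_class (u ++ v) = word_class u * word_class v.
Proof. by rewrite -pres_mulE. Qed.

Lemma word_classV u : word_class (wordV u) = (word_class u)^-1.
Proof. by rewrite -pres_invE. Qed.

Section Lift.
Variables (K : groupType) (f : X -> K).

Definition letter_eval (a : X * bool) : K := if a.2 then f a.1 else (f a.1)^-1.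

Definition word_eval (u : word X) : K := \prod_(a <- u) letter_eval a.

Lemma word_eval_cat u v : word_eval (u ++ v) = word_eval u * word_eval v.
Proof. exact: big_cat. Qed.

Hypothesis fR : forall u v, R u v -> word_eval u = word_eval v.

Lemma word_eval_eq u v : word_eq R u v -> word_eval u = word_eval v.
Proof.
elim=> {u v} [u v p q /fR e|[x b] p q|//|u v _ ->//|u v w _ -> _ ->//].
  by rewrite !word_eval_cat e.
rewrite !word_eval_cat [word_eval [:: _; _]]/word_eval !big_cons big_nil mulg1.
by case: b; rewrite /letter_eval /= ?mulgV ?mulVg mul1g.
Qed.

Definition pres_lift (x : presented) : K := word_eval (repr x).

Lemma pres_liftE u : pres_lift (word_class u) = word_eval u.
Proof. exact/word_eval_eq/word_eq_repr. Qed.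

Lemma pres_lift_monoid_morphism : monoid_morphism pres_lift.
Proof.
split=> [|x y]; first by rewrite -word_class1 pres_liftE /word_eval big_nil.
rewrite -(word_classK x) -(word_classK y) -word_classM !pres_liftE.
exact: word_eval_cat.
Qed.

Lemma pres_lift_exists : exists phi : {hom presented -> K},
  forall x, phi (pres_gen x) = f x.
Proof.
pose m := isUMagmaMorphism.Build _ _ pres_lift pres_lift_monoid_morphism.
pose phi : {hom presented -> K} := HB.pack pres_lift m.
exists phi => x; rewrite /= pres_liftE /word_eval big_seq1.
by [].
Qed.

End Lift.

Lemma pres_hom_ext (K : groupType) (phi psi : {hom presented -> K}) :
  (forall x, phi (pres_gen x) = psi (pres_gen x)) -> phi =1 psi.
Proof.
move=> e x; rewrite -(word_classK x); elim: (repr x) => [|[y b] u IH].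
  by rewrite word_class1 !gmulf1.
rewrite -cat1s word_classM !gmulfM IH; congr (_ * _); case: b; first exact: e.
have -> : word_class [:: (y, false)] = (pres_gen y)^-1 by rewrite -word_classV.
by rewrite !gmulfV e.
Qed.

End Presentation.

Definition free_group (n : nat) : groupType :=
  @presented 'I_n (fun _ _ => False).

Definition free_gen (n : nat) (i : 'I_n) : free_group n := pres_gen _ i.

Lemma free_group_lift (n : nat) (K : groupType) (f : 'I_n -> K) :
  exists2 phi : {hom free_group n -> K},
    forall i, phi (free_gen i) = f i &
    forall psi : {hom free_group n -> K},
      (forall i, psi (free_gen i) = f i) -> psi =1 phi.
Proof.
have [//|phi phiE] := @pres_lift_exists _ (fun _ _ => False) K f.
exists phi => // psi psiE; apply: pres_hom_ext => i.
by rewrite [LHS]psiE phiE.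
Qed.

(* The free product, presented by the disjoint union of the multiplication    *)
(* tables of the two factors.                                                 *)
Inductive freeprod_rel (G H : groupType) : word (G + H) -> word (G + H) -> Prop :=
| FreeprodRelL g g' : freeprod_rel [:: (inl g, true); (inl g', true)]
                                   [:: (inl (g * g'), true)]
| FreeprodRelR h h' : freeprod_rel [:: (inr h, true); (inr h', true)]
                                   [:: (inr (h * h'), true)].

Definition freeprod (G H : groupType) : groupType :=
  @presented (G + H)%type (@freeprod_rel G H).

Section FreeProduct.
Variables G H : groupType.

Definition freeprod_inl (g : G) : freeprod G H := pres_gen _ (inl g).
Definition freeprod_inr (h : H) : freeprod G H := pres_gen _ (inr h).

Lemma freeprod_inlF : {morph freeprod_inl : x y / x / y}.
Proof.
have M : {morph freeprod_inl : x y / x * y}.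
  move=> x y; rewrite /freeprod_inl /pres_gen -word_classM.
  apply/word_classP/WordEqSym.
  exact: (@WordEqRel _ _ _ _ [::] [::] (FreeprodRelL _ x y)).
by move=> x y; apply: (@mulIg _ (freeprod_inl y)); rewrite -M !mulgVK.
Qed.

Lemma freeprod_inrF : {morph freeprod_inr : x y / x / y}.
Proof.
have M : {morph freeprod_inr : x y / x * y}.
  move=> x y; rewrite /freeprod_inr /pres_gen -word_classM.
  apply/word_classP/WordEqSym.
  exact: (@WordEqRel _ _ _ _ [::] [::] (FreeprodRelR _ x y)).
by move=> x y; apply: (@mulIg _ (freeprod_inr y)); rewrite -M !mulgVK.
Qed.

HB.instance Definition _ :=
  isGroupMorphism.Build G (freeprod G H) freeprod_inl freeprod_inlF.
HB.instance Definition _ :=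
  isGroupMorphism.Build H (freeprod G H) freeprod_inr freeprod_inrF.

Lemma freeprod_lift (K : groupType) (f : {hom G -> K}) (f' : {hom H -> K}) :
  exists2 phi : {hom freeprod G H -> K},
    (forall g, phi (freeprod_inl g) = f g) /\
    (forall h, phi (freeprod_inr h) = f' h) &
    forall psi : {hom freeprod G H -> K},
      (forall g, psi (freeprod_inl g) = f g) ->
      (forall h, psi (freeprod_inr h) = f' h) -> psi =1 phi.
Proof.
pose k (x : G + H) : K := match x with inl g => f g | inr h => f' h end.
have kR u v : freeprod_rel u v -> word_eval k u = word_eval k v.
  by case=> x y; rewrite /word_eval !big_cons !big_nil /letter_eval /= !mulg1
    gmulfM.
have [phi phiE] := pres_lift_exists kR.
exists phi; first by split=> x; rewrite phiE.
move=> psi psil psir; apply: pres_hom_ext => -[x|x]; rewrite phiE.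
  exact: psil.
exact: psir.
Qed.

End FreeProduct.

Arguments freeprod_inl {G H}.
Arguments freeprod_inr {G H}.

Definition mixed_identity_free (G : groupType) : Prop :=
  forall (n : nat) (w : freeprod G (free_group n)), w <> 1 ->
    exists2 phi : {hom freeprod G (free_group n) -> G},
      (forall g : G, phi (freeprod_inl g) = g) & phi w <> 1.

(* Up to isomorphism, subgroups of G are the sources of injective             *)
(* homomorphisms to G and quotients of G the targets of surjective ones, so   *)
(* the class is closed under isomorphism (case of an isomorphism in EASub).   *)
(* EAExt: G is an extension of Q by N. EAUnion: G is the union of a family of *)
(* subgroups (the images of the e i) that is directed under inclusion; it is  *)
(* nonempty since its union contains 1.                                       *)
Inductive elementary_amenable : groupType -> Prop :=
| EAFinite (G : groupType) (s : seq G) :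
    (forall x : G, x \in s) -> elementary_amenable G
| EAAbelian (G : groupType) :
    (forall x y : G, commute x y) -> elementary_amenable G
| EASub (H G : groupType) (f : {hom H -> G}) :
    injective f -> elementary_amenable G -> elementary_amenable H
| EAQuotient (G Q : groupType) (f : {hom G -> Q}) :
    (forall y, exists x, f x = y) ->
    elementary_amenable G -> elementary_amenable Q
| EAExt (N G Q : groupType) (i : {hom N -> G}) (p : {hom G -> Q}) :
    injective i -> (forall y, exists x, p x = y) ->
    (forall x : G, p x = 1 <-> exists y, i y = x) ->
    elementary_amenable N -> elementary_amenable Q -> elementary_amenable G
| EAUnion (I : Type) (G : groupType) (H : I -> groupType)
    (e : forall i, {hom H i -> G}) :
    (forall i, injective (e i)) ->
    (forall i j, exists k,
       range (e i) `<=` range (e k) /\ range (e j) `<=` range (e k)) ->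
    (forall x : G, exists i, range (e i) x) ->
    (forall i, elementary_amenable (H i)) -> elementary_amenable G.

Definition subgroup_set (G : groupType) (H : set G) : Prop :=
  H 1 /\ forall x y, H x -> H y -> H (x / y).

Definition generated_subgroup (G : groupType) (A : set G) : set G :=
  smallest (@subgroup_set G) A.

(* Main.v *)
(* Let S be the union of the sets of integers S_k, where S_0 = {0} and S_(k+1)
   is the union of S_k, of S_k + 4 * 8^k and of {2 * 8^k}; let G be the group of
   permutations of the integers generated by the translation t : x -> x + 1 and
   by the product a of the transpositions (s s+1) for s in S.

   Elementary amenability: for every m the m-neighbourhood of S misses an
   arithmetic progression, so finitely many conjugates of a by powers of t
   preserve all cells of a partition of the integers into intervals of equal
   length, and generate a finite group. Hence G is (locally finite)-by-Z.

   High transitivity: S has arbitrarily isolated points, so on any window a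
   suitable conjugate of a acts as the single transposition (x x+1).

   Infinite supports: each window of S recurs at translates by 4 * 8^k for all
   large k, and so does each non-fixed point of an element of G.

   The last two properties imply that G is mixed identity-free: a reduced word
   g_0 x_1 g_1 ... x_k g_k is evaluated letter by letter from the right, the
   value of each variable at each new point being a fresh point that the next
   coefficient sends to a fresh point; high transitivity realizes the finitely
   many prescribed values. *)
Require Import Defs.
From HB Require Import structures.
From mathcomp Require Import all_boot.
From mathcomp Require Import boolp classical_sets.
From mathcomp Require Import all_order all_algebra zify.

Set Implicit Arguments.
Unset Strict Implicit.
Unset Printing Implicit Defensive.

Local Open Scope group_scope.
Local Open Scope classical_set_scope.

(** * Permutation groups and elementary amenability *)

Section Subgroup.
Variables (G : groupType) (P : set G).

Definition subgroup_pred : pred G := fun x => `[< P x >].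

(** The proof of [subgroup_set P] is an argument of the type so that the group structure can be
    inferred from the type alone. *)
Definition sgrp of subgroup_set P := {x : G | subgroup_pred x}.

Variable gP : subgroup_set P.

HB.instance Definition _ := SubType.on (sgrp gP).
HB.instance Definition _ := [Choice of sgrp gP by <:].

Lemma subgroup_predP : group_closed subgroup_pred.
Proof.
case: gP => P1 PF; split; first exact/asboolP.
by move=> x y /asboolP Px /asboolP Py; apply/asboolP/PF.
Qed.

HB.instance Definition _ :=
  SubChoice_isSubGroup.Build G subgroup_pred (sgrp gP) subgroup_predP.

Definition sgrp_val : {hom sgrp gP -> G} := val : sgrp gP -> G.

Lemma sgrp_val_inj : injective sgrp_val.
Proof. exact: val_inj. Qed.

Lemma sgrp_valP (x : sgrp gP) : P (sgrp_val x).
Proof. exact/asboolP/(valP x). Qed.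

Definition sgrp_in (x : G) (Px : P x) : sgrp gP := Sub x (asboolT Px).

Lemma sgrp_inK (x : G) (Px : P x) : sgrp_val (sgrp_in Px) = x.
Proof. exact: SubK. Qed.

Lemma sgrp_range (x : G) : range sgrp_val x <-> P x.
Proof.
split=> [[y _ <-]|Px]; first exact: sgrp_valP.
by exists (sgrp_in Px).
Qed.

Lemma subgroup_setM (x y : G) : P x -> P y -> P (x * y).
Proof.
case: gP => P1 PF Px Py; rewrite -(invgK y); apply: (PF) => //.
by rewrite -[y^-1]mul1g; apply: PF.
Qed.

Lemma subgroup_setV (x : G) : P x -> P x^-1.
Proof. by case: gP => P1 PF Px; rewrite -[x^-1]mul1g; apply: PF. Qed.

End Subgroup.

Arguments sgrp_val {G P gP}.

Lemma generated_subgroupP (G : groupType) (A : set G) :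
  subgroup_set (generated_subgroup A).
Proof.
split=> [B [[] //]|x y Ax Ay B BP]; case: (BP) => -[_ BF] _.
by apply: BF; [exact: Ax | exact: Ay].
Qed.

Lemma sgrp_hom (G H : groupType) (P : set G) (gP : subgroup_set P)
    (Q : set H) (gQ : subgroup_set Q) (f : {hom G -> H}) :
  (forall x, P x -> Q (f x)) ->
  exists phi : {hom sgrp gP -> sgrp gQ},
    forall x, sgrp_val (phi x) = f (sgrp_val x).
Proof.
move=> PQ.
pose k (x : sgrp gP) : sgrp gQ := sgrp_in gQ (PQ _ (sgrp_valP x)).
have kE x : sgrp_val (k x) = f (sgrp_val x) by rewrite sgrp_inK.
have kM : monoid_morphism k.
  split=> [|x y]; apply: (@sgrp_val_inj _ _ gQ).
    by rewrite kE !gmulf1.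
  by rewrite kE !gmulfM !kE.
pose m := isUMagmaMorphism.Build _ _ k kM.
by exists (HB.pack k m : {hom sgrp gP -> sgrp gQ}).
Qed.

Lemma EA_injective_fin (G : groupType) (T : finType) (h : G -> T) :
  injective h -> elementary_amenable G.
Proof.
(* [s] holds a preimage of each [t], with 1 as the default off the image of [h]. *)
move=> hI; pose s := [seq xget 1 [set x | h x = t] | t <- enum T].
apply: (@EAFinite _ s) => x; apply/mapP; exists (h x).
  by rewrite mem_enum.
by apply: hI; case: xgetP => [y _ -> //|/(_ x)]; case.
Qed.

Lemma EA_directed_sets (I : Type) (G : groupType) (P : I -> set G)
    (gP : forall i, subgroup_set (P i)) :
  (forall i j, exists k, P i `<=` P k /\ P j `<=` P k) ->
  (forall x, exists i, P i x) ->
  (forall i, elementary_amenable (sgrp (gP i))) -> elementary_amenable G.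
Proof.
move=> dir cov ea; apply: (EAUnion (e := fun i => @sgrp_val _ _ (gP i))) => //.
- by move=> i; exact: sgrp_val_inj.
- move=> i j; have [k [ik jk]] := dir i j; exists k.
  by split=> x /sgrp_range xi; apply/sgrp_range; [exact: ik | exact: jk].
- by move=> x; have [i xi] := cov x; exists i; exact/sgrp_range.
Qed.

(** * The symmetric group of a type *)

Record bijection (T : Type) := Bijection {
  bij_fun :> T -> T;
  bij_inv : T -> T;
  bij_funK : cancel bij_fun bij_inv;
  bij_invK : cancel bij_inv bij_fun }.

Section BijectionGroup.
Variable T : Type.
Implicit Types f g h : bijection T.

HB.instance Definition _ := gen_eqMixin (bijection T).
HB.instance Definition _ := gen_choiceMixin (bijection T).

Lemma bijP f g : f =1 g -> f = g.
Proof.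
case: f g => f f' fK f'K [g g' gK g'K] /= /funext e; move: gK g'K.
rewrite -{g}e => gK g'K.
have e' : f' = g' by apply: funext => x; rewrite -{1}(g'K x) fK.
move: gK g'K; rewrite -{g'}e' => gK g'K.
by congr Bijection; exact: Prop_irrelevance.
Qed.

Definition bij_one := @Bijection T id id (frefl _) (frefl _).
Definition bij_mul f g :=
  Bijection (can_comp (@bij_funK _ f) (@bij_funK _ g))
            (can_comp (@bij_invK _ g) (@bij_invK _ f)).
Definition bij_opp f := Bijection (@bij_invK _ f) (@bij_funK _ f).

Lemma bij_mulA : associative bij_mul.
Proof. by move=> f g h; exact: bijP. Qed.
Lemma bij_mul1 : left_id bij_one bij_mul.
Proof. by move=> f; exact: bijP. Qed.
Lemma bij_mulr1 : right_id bij_one bij_mul.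
Proof. by move=> f; exact: bijP. Qed.
Lemma bij_mulV : left_inverse bij_one bij_opp bij_mul.
Proof. by move=> f; apply: bijP => x; exact: bij_funK. Qed.
Lemma bij_mulrV : right_inverse bij_one bij_opp bij_mul.
Proof. by move=> f; apply: bijP => x; exact: bij_invK. Qed.

HB.instance Definition _ := isGroup.Build (bijection T)
  bij_mulA bij_mul1 bij_mulr1 bij_mulV bij_mulrV.

Lemma bijM f g x : (f * g) x = f (g x). Proof. by []. Qed.
Lemma bij1 x : (1 : bijection T) x = x. Proof. by []. Qed.
Lemma bijVK f x : f^-1 (f x) = x. Proof. exact: bij_funK. Qed.
Lemma bijKV f x : f (f^-1 x) = x. Proof. exact: bij_invK. Qed.
Lemma bij_injective f : injective f. Proof. exact: can_inj (bijVK f). Qed.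

End BijectionGroup.

(** * Groups acting within fibers of bounded size *)

Section Fiberwise.
Variables (G : groupType) (X Y : Type) (F : finType).
Variables (rho : {hom G -> bijection X}) (pi : X -> Y) (lam : X -> F).
Hypothesis rhoI : injective rho.
Hypothesis pi_lam : forall x x', pi x = pi x' -> lam x = lam x' -> x = x'.
Hypothesis pi_rho : forall g x, pi (rho g x) = pi x.

(** With [lam] labelling the points of each fiber of [pi], the action of [g] on labels depends on
    the fiber only through its colour. *)
Definition uniform_on (T : Type) (chi : Y -> T) (g : G) :=
  forall x x', chi (pi x) = chi (pi x') -> lam x = lam x' ->
    lam (rho g x) = lam (rho g x').

Definition uniform_set (i : {T : finType & Y -> T}) : set G :=
  [set g | uniform_on (projT2 i) g /\ uniform_on (projT2 i) g^-1].

Lemma uniform_onM T (chi : Y -> T) g h :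
  uniform_on chi g -> uniform_on chi h -> uniform_on chi (g * h).
Proof.
move=> ug uh x x' e l; rewrite gmulfM !bijM; apply: ug; last exact: uh.
by rewrite !pi_rho.
Qed.

Lemma uniform_setP i : subgroup_set (uniform_set i).
Proof.
split=> [|g h [g1 g2] [h1 h2]].
  by split=> x x' _; rewrite ?invg1 gmulf1.
by split; rewrite ?invgF; exact: uniform_onM.
Qed.

(** An element is determined by a finite table: for each colour and label, the label of the image of
    one chosen point, if there is any. *)
Lemma EA_uniform_set i : elementary_amenable (sgrp (uniform_setP i)).
Proof.
case: i => T chi.
pose Q (p : T * F) := [set x | chi (pi x) = p.1 /\ lam x = p.2].
pose h (g : sgrp (uniform_setP (existT _ T chi))) : {ffun T * F -> option F} :=
  [ffun p => omap (fun x => lam (rho (sgrp_val g) x))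
    (if pselect (exists x, Q p x) is left e then Some (projT1 (cid e))
     else None)].
apply: (@EA_injective_fin _ _ h) => g g' /ffunP e.
apply/sgrp_val_inj/rhoI/bijP => x.
apply: pi_lam; first by rewrite !pi_rho.
have := e (chi (pi x), lam x); rewrite !ffunE.
case: pselect => [p|[]]; last by exists x.
case: cid => /= y [/= y1 y2] [] e'.
have [u _] := sgrp_valP g; have [u' _] := sgrp_valP g'.
by rewrite -(u y x y1 y2) -(u' y x y1 y2).
Qed.

(* G is the directed union of the subgroups that act alike on all fibers of the
   same colour, over all finite colourings of Y; these subgroups are finite. *)
Lemma EA_fiberwise : elementary_amenable G.
Proof.
apply: (EA_directed_sets (gP := uniform_setP)).
- move=> [T chi] [T' chi'].
  exists (existT (fun T : finType => Y -> T) ((T * T')%type : finType)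
    (fun y => (chi y, chi' y))).
  by split=> g [u v]; split=> x x' [e e'] l; (apply: u || apply: v).
(* Colour a fiber by the graph of [g] on its labels. Equal colours give equal actions of [g], and of
   [g^-1] by reading the pairs backwards. *)
- move=> g; pose chi y := [set p : F * F |
    `[< exists2 x, pi x = y & p = (lam x, lam (rho g x)) >]]%SET.
  have chiP x x' : chi (pi x) = chi (pi x') ->
      exists2 z, pi z = pi x' & (lam x, lam (rho g x)) = (lam z, lam (rho g z)).
    move=> e; have : (lam x, lam (rho g x)) \in chi (pi x).
      by rewrite inE; apply/asboolP; exists x.
    by rewrite e inE => /asboolP.
  exists (existT (fun T : finType => Y -> T) ({set F * F} : finType) chi).
  split=> /= x x' e l.
    have [z zx [l1 ->]] := chiP _ _ e; congr (lam (rho g _)).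
    by apply: pi_lam => //; rewrite -l1.
  rewrite -(pi_rho g^-1 x) -(pi_rho g^-1 x') in e.
  have [z zx [-> ]] := chiP _ _ e; rewrite gmulfV !bijKV l => l'.
  congr lam; apply: (@bij_injective _ (rho g)); rewrite bijKV.
  apply: pi_lam => //.
  by rewrite pi_rho zx pi_rho.
- exact: EA_uniform_set.
Qed.

End Fiberwise.

(** * Highly transitive actions with infinite supports *)

Section ReducedForm.
Variables (G : groupType) (n : nat).
Local Notation letter := ('I_n * bool * G)%type.
Local Notation M := (freeprod G (free_group n)).

Definition fletter (i : 'I_n) (b : bool) : M :=
  if b then freeprod_inr (free_gen i) else (freeprod_inr (free_gen i))^-1.

Fixpoint syllables (g0 : G) (l : seq letter) : M :=
  if l is (i, b, g) :: l' then
    freeprod_inl g0 * (fletter i b * syllables g l')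
  else freeprod_inl g0.

(** A letter carries the coefficient on its right, so [x.2] is all that separates [x] from the next
    letter [y]. *)
Definition noncancelling (x y : letter) :=
  [|| x.1.1 != y.1.1, x.1.2 == y.1.2 | x.2 != 1].

Definition reduced_form (w : M) :=
  exists g0 l, sorted noncancelling l /\ w = syllables g0 l.

Lemma syllablesM g g0 l :
  freeprod_inl g * syllables g0 l = syllables (g * g0) l.
Proof. by case: l => [|[[i b] h] l] /=; rewrite gmulfM -?mulgA. Qed.

Lemma reduced_form_inl g w :
  reduced_form w -> reduced_form (freeprod_inl g * w).
Proof.
by move=> [g0 [l [rl ->]]]; exists (g * g0), l; rewrite syllablesM.
Qed.

Lemma fletterV i b : fletter i b * fletter i (~~ b) = 1.
Proof. by case: b; rewrite /fletter /= ?mulgV ?mulVg. Qed.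

(** The new letter either extends the reduced list or cancels its first letter, and the tail of a
    reduced list is reduced. *)
Lemma reduced_form_fletter i b w :
  reduced_form w -> reduced_form (fletter i b * w).
Proof.
move=> [g0 [l [rl ->]]].
have cons : sorted noncancelling ((i, b, g0) :: l) ->
    reduced_form (fletter i b * syllables g0 l).
  by exists 1, ((i, b, g0) :: l); split=> //=; rewrite gmulf1 mul1g.
case: l rl cons => [|[[j c] g] l] rl cons; first exact: cons.
have [h|] := boolP (noncancelling (i, b, g0) (j, c, g)).
  by apply: cons; rewrite /= h.
rewrite /noncancelling /= !negb_or !negbK => /and3P[/eqP <- bc /eqP ->].
have -> : c = ~~ b by case: b c bc {rl cons} => [] [].
exists g, l; split; last by rewrite gmulf1 mul1g mulgA fletterV mul1g.
exact: path_sorted rl.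
Qed.

Lemma word_class_cons (X : choiceType) (R : word X -> word X -> Prop) x b u :
  word_class R ((x, b) :: u) =
  (if b then pres_gen R x else (pres_gen R x)^-1) * word_class R u.
Proof.
rewrite -cat1s word_classM; congr (_ * _); case: b => //.
by rewrite -word_classV.
Qed.

Lemma reduced_form_inr h w :
  reduced_form w -> reduced_form (freeprod_inr h * w).
Proof.
move=> rw; rewrite -(word_classK h); elim: (repr h) => [|[i b] u IH].
  by rewrite word_class1 gmulf1 mul1g.
rewrite word_class_cons gmulfM -mulgA.
case: b; first exact: (reduced_form_fletter i true IH).
by rewrite gmulfV; exact: (reduced_form_fletter i false IH).
Qed.

Lemma exists_reduced_form w : reduced_form w.
Proof.
rewrite -(word_classK w); elim: (repr w) => [|[[g|h] b] u IH].
- by exists 1, [::]; rewrite word_class1 /= gmulf1.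
- rewrite word_class_cons; case: b; first exact: (reduced_form_inl g).
  have := reduced_form_inl g^-1 IH; by rewrite gmulfV.
- rewrite word_class_cons; case: b; first exact: (reduced_form_inr h).
  have := reduced_form_inr h^-1 IH; by rewrite gmulfV.
Qed.

End ReducedForm.

Section Transitivity.
Variables (G : groupType) (X : eqType) (rho : {hom G -> bijection X}).

Definition highly_transitive := forall s t : seq X,
  uniq s -> uniq t -> size s = size t -> exists g, map (rho g) s = t.

Definition infinite_supports :=
  forall g, g <> 1 -> forall s : seq X, exists2 x, x \notin s & rho g x <> x.

Hypothesis rho_ht : highly_transitive.
Hypothesis rho_inf : infinite_supports.
Hypothesis Xinf : forall s : seq X, exists x, x \notin s.

Lemma fresh_point g (s : seq X) :
  exists x, [/\ x \notin s, rho g x \notin s & g <> 1 -> rho g x <> x].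
Proof.
have fs x : x \notin s ++ map (rho g^-1) s -> x \notin s /\ rho g x \notin s.
  rewrite mem_cat negb_or => /andP[-> xs]; split=> //.
  apply: contra xs => xs; apply/mapP; exists (rho g x) => //.
  by rewrite gmulfV bijVK.
have [g1|/eqP g1] := eqVneq g 1.
  by have [x /fs[xs gxs]] := Xinf (s ++ map (rho g^-1) s); exists x; split.
by have [x /fs[xs gxs] gx] := rho_inf g1 (s ++ map (rho g^-1) s); exists x.
Qed.

Section Evaluation.
Variable n : nat.
Local Notation constraint := ('I_n * (X * X))%type.
Implicit Type cs : seq constraint.

Definition domain_of (i : 'I_n) (b : bool) cs : seq X :=
  [seq (if b then c.2.1 else c.2.2) | c <- cs & c.1 == i].

Definition satisfies (v : 'I_n -> G) cs :=
  forall c, c \in cs -> rho (v c.1) c.2.1 = c.2.2.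

(** The constraints on one variable form a finite partial injection, which high transitivity extends
    to an element of [G]. *)
Lemma satisfiable cs :
  (forall i b, uniq (domain_of i b cs)) -> exists v, satisfies v cs.
Proof.
move=> ucs.
have /choice[v vP] : forall i, exists g,
    map (rho g) (domain_of i true cs) = domain_of i false cs.
  by move=> i; apply: rho_ht; rewrite ?ucs // !size_map.
exists v => -[i [x y]] /= ic; have := vP i.
rewrite /domain_of -map_comp => /eq_in_map/(_ (i, (x, y))) /=; apply.
by rewrite mem_filter eqxx.
Qed.

Local Notation M := (freeprod G (free_group n)).

(* The constraint (i, (x, y)) prescribes that the i-th variable sends x to y, and
   [domain_of i b] lists the points where x_i (b = true) or its inverse
   (b = false) has been prescribed. The third clause keeps z available for any
   next letter that does not cancel. *)
Lemma trajectory (g0 : G) (l : seq ('I_n * bool * G)) :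
  sorted (@noncancelling _ _) l -> exists p z cs,
  [/\ forall i b, uniq (domain_of i b cs),
      forall phi : {hom M -> G}, (forall g, phi (freeprod_inl g) = g) ->
        satisfies (fun i => phi (freeprod_inr (free_gen i))) cs ->
        rho (phi (syllables g0 l)) p = z,
      forall i b, sorted (@noncancelling _ _) ((i, b, g0) :: l) ->
        z \notin domain_of i b cs &
      l <> [::] -> z <> p].
Proof.
elim: l g0 => [|[[i b] g] l IH] g0 /= sl.
  have [p _] := Xinf [::]; exists p, (rho g0 p), [::]; split=> //.
  by move=> phi phi1 _; rewrite /= phi1.
have [p [z [cs [ucs phics zcs _]]]] := IH g (path_sorted sl).
(* The points in use: the next value [q] and its image under [g0] are chosen outside. *)
pose U := p :: z :: map (fun c : constraint => c.2.1) cs ++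
  map (fun c : constraint => c.2.2) cs.
have sub j c x : x \notin U -> x \notin domain_of j c cs.
  rewrite !inE mem_cat !negb_or => /and4P[_ _ x1 x2].
  apply/mapP => -[e]; rewrite mem_filter => /andP[_ ecs] xe.
  move: x1 x2; rewrite xe.
  by case: c xe => _; rewrite ?(map_f (fun c : constraint => c.2.1)) //
    ?(map_f (fun c : constraint => c.2.2)).
have [q [qU gqU g0q]] := fresh_point g0 U.
have [gqp gqz] : rho g0 q <> p /\ rho g0 q <> z.
  by move: gqU; rewrite !inE !negb_or => /and3P[/eqP gqp /eqP gqz _].
(* The letter has to send [z] to [q]; for an inverse letter the variable itself sends [q] to [z]. *)
exists p, (rho g0 q), ((i, if b then (z, q) else (q, z)) :: cs).
have dE j c : domain_of j c ((i, if b then (z, q) else (q, z)) :: cs) =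
    if i == j then (if b == c then z else q) :: domain_of j c cs
    else domain_of j c cs.
  by rewrite /domain_of /=; case: eqP => //= _; case: b c {sl} => [] [].
split=> //.
- move=> j c; rewrite dE; case: eqP => [<-|_] //=; rewrite ucs andbT.
  by case: eqP => [<-|_]; [exact: zcs | exact: sub].
- move=> phi phi1 sat; rewrite !gmulfM phi1 !bijM phics //; last first.
    by move=> c ccs; apply: sat; rewrite inE ccs orbT.
  congr (rho g0 _); have := sat _ (mem_head _ _); rewrite /fletter /=.
  by case: b {sl zcs sat dE} => //= <-; rewrite !gmulfV bijVK.
- move=> j c /=; rewrite dE => /andP[nc _].
  case: eqP => [ij|_]; last exact: sub.
  (* If [b = c] the new entry is [z], avoided by freshness. Otherwise it is [q], and noncancellation
     forces [g0 != 1], so that [g0] moves [q]. *)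
  rewrite inE negb_or sub // andbT; case: (b =P c) => [_|bc]; first exact/eqP.
  apply/eqP/g0q/eqP; move: nc; rewrite /noncancelling /= ij eqxx /=.
  by rewrite eq_sym; move: (bc) => /eqP/negbTE ->.
Qed.

End Evaluation.

Lemma highly_transitive_MIF : mixed_identity_free G.
Proof.
move=> n w w1; have [g0 [l [sl wE]]] := exists_reduced_form w.
have [p [z [cs [ucs phics _ zp]]]] := trajectory g0 sl.
have [v vcs] := satisfiable ucs.
have [f' f'E _] := free_group_lift v.
have [phi [phil phir] _] := freeprod_lift (idfun : {hom G -> G}) f'.
(* Without letters [w] is a coefficient, which [phi] fixes; otherwise [phi w] moves [p]. *)
exists phi => // phiw; case: l sl wE phics zp => [|x l] sl wE phics zp.
  have g01 : g0 = 1 by rewrite -phiw wE /= phil.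
  by apply: w1; rewrite wE /= g01 gmulf1.
apply: zp => //; rewrite -(phics phi phil) -?wE ?phiw ?gmulf1 //.
by move=> c /vcs; rewrite phir f'E.
Qed.

End Transitivity.

(** * Approximating transpositions *)

Lemma absz_bounded (s : seq int) :
  exists L : nat, forall y, y \in s -> (`|y| <= L)%N.
Proof.
elim: s => [|x s [L IH]]; first by exists 0%N.
exists (maxn `|x| L) => y; rewrite inE => /orP[/eqP ->|/IH]; lia.
Qed.

Section LocalTranspositions.
Variables (P : set (bijection int)) (gP : subgroup_set P).

Definition swap (x z y : int) := if y == x then z else if y == z then x else y.

(* An element that agrees with the transposition (x z) on [-L, L] may act in any
   way elsewhere. *)
Definition approx_swap (x z : int) := forall L : nat,
  exists2 g, P g & forall y, (`|y| <= L)%N -> g y = swap x z y.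

Lemma approx_swap_sym x z : approx_swap x z -> approx_swap z x.
Proof.
move=> h L; have [g Pg gE] := h L; exists g => // y /gE ->.
by rewrite /swap; case: eqP => [->|//]; case: eqP.
Qed.

(* (x z) = (y z) (x y) (y z) *)
Lemma approx_swap_trans x y z : x != y -> y != z -> x != z ->
  approx_swap x y -> approx_swap y z -> approx_swap x z.
Proof.
(* The window of radius [L'] contains [x], [y] and [z], so the swaps map it to itself. *)
move=> xy yz xz fxy hyz L; pose L' := (L + `|x| + `|y| + `|z|)%N.
have [f Pf fE] := fxy L'; have [h Ph hE] := hyz L'.
exists (h * f * h); first by do 2?apply: (subgroup_setM gP).
move=> u uL; rewrite !bijM.
have swL a b v : (`|a| <= L')%N -> (`|b| <= L')%N -> (`|v| <= L')%N ->
  (`|swap a b v| <= L')%N by rewrite /swap; case: eqP => // _; case: eqP.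
have uL' : (`|u| <= L')%N by lia.
have hu : (`|h u| <= L')%N by rewrite hE //; apply: swL => //; lia.
have fhu : (`|f (h u)| <= L')%N by rewrite fE //; apply: swL => //; lia.
rewrite (hE _ fhu) (fE _ hu) (hE u uL').
rewrite /swap; repeat case: eqP => //; lia.
Qed.

Hypothesis approx_succ : forall x, approx_swap x (x + 1)%R.

(** Adjacent transpositions compose along the interval, by induction on its length; symmetry gives
    the case [z < x]. *)
Lemma approx_swap_neq x z : x != z -> approx_swap x z.
Proof.
have lt n y : approx_swap y (y + n.+1%:Z)%R.
  elim: n y {x z} => [//|n IH] x.
  apply: (@approx_swap_trans x (x + n.+1%:Z)%R); [lia|lia|lia|exact: IH|].
  have -> : (x + n.+2%:Z)%R = (x + n.+1%:Z + 1)%R by lia.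
  exact: approx_succ.
move=> xz; have [xltz|zltx] : (x < z)%R \/ (z < x)%R by lia.
  have -> : z = (x + (`|z - x|%N.-1).+1%:Z)%R by lia.
  exact: lt.
have -> : x = (z + (`|z - x|%N.-1).+1%:Z)%R by lia.
exact/approx_swap_sym/lt.
Qed.

Lemma move_point (F : seq int) x z : x \notin F -> z \notin F ->
  exists g, [/\ P g, g x = z & {in F, forall y, g y = y}].
Proof.
move=> xF zF; have [->|xz] := eqVneq x z.
  by exists 1; split=> //; case: gP.
have [L LP] := absz_bounded (x :: F).
have [g Pg gE] := approx_swap_neq xz L; exists g; split=> //.
  by rewrite gE ?LP ?mem_head // /swap eqxx.
move=> y yF; rewrite gE ?LP ?inE ?yF ?orbT // /swap.
case: eqP => [e|_]; first by rewrite -e yF in xF.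
by case: eqP => // e; rewrite -e yF in zF.
Qed.

(** Once [s] has been carried to [t], [move_point] corrects the image of the additional point while
    fixing [t]. *)
Lemma approx_swap_highly_transitive : highly_transitive (@sgrp_val _ _ gP).
Proof.
elim=> [|x s IH] [|y t] //=; first by exists 1.
move=> /andP[xs us] /andP[yt ut] [est].
have [g gst] := IH t us ut est.
have gxt : sgrp_val g x \notin t.
  apply: contra xs; rewrite -gst => /mapP[x' x's e].
  by rewrite (bij_injective e).
have [h [Ph hx hF]] := move_point gxt yt.
exists (sgrp_in gP Ph * g).
have E u : sgrp_val (sgrp_in gP Ph * g) u = h (sgrp_val g u).
  by rewrite gmulfM bijM sgrp_inK.
rewrite E hx (eq_map E); congr cons.
rewrite (map_comp h (sgrp_val g)) gst -[RHS]map_id; exact/eq_in_map.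
Qed.

End LocalTranspositions.

(** * The sparse set *)

Local Notation pow8 k := (Posz (8 ^ k)%N).

Fixpoint level (k : nat) (x : int) : bool :=
  if k is k'.+1 then
    [|| level k' x, level k' (x - 4 * pow8 k')%R | x == (2 * pow8 k')%R]
  else x == 0%R.

(** In base 8 these are the natural numbers with all digits 0 or 4, except that the lowest nonzero
    digit may also be 2. *)
Definition sparse (x : int) : bool := `[< exists k, level k x >].

Lemma level_bound k x : level k x -> (0 <= x < pow8 k)%R.
Proof.
elim: k x => [|k IH] x /=; first by move=> /eqP ->.
rewrite expnS; case/or3P=> [/IH|/IH|/eqP]; lia.
Qed.

Lemma level_even k x : level k x -> exists y, x = (2 * y)%R.
Proof.
elim: k x => [|k IH] x /=; first by move=> /eqP ->; exists 0%R.
case/or3P=> [/IH//|/IH[y e]|/eqP ->]; last by exists (pow8 k).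
exists (y + 2 * pow8 k)%R; lia.
Qed.

Lemma level_leq j k x : (j <= k)%N -> level j x -> level k x.
Proof.
move=> /subnK <-; elim: (k - j)%N => [//|i IH] /IH h.
by rewrite addSn /= h.
Qed.

(** Levels beyond [k] add only points that are at least 8^k. *)
Lemma level_low j k x : level j x -> (x < pow8 k)%R -> level k x.
Proof.
elim: j => [|j IH]; first by move=> h _; exact: level_leq h.
have [jk|kj] := ltnP j k; first by move=> h _; exact: level_leq h.
have : (8 ^ k <= 8 ^ j)%N by rewrite leq_exp2l.
move=> /= kj8; case/or3P=> [/IH//|/level_bound|/eqP]; lia.
Qed.

Lemma sparse_level k x : sparse x -> (x < pow8 k)%R -> level k x.
Proof. by move=> /asboolP[j jx]; exact: level_low jx. Qed.

Lemma level_sparse k x : level k x -> sparse x.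
Proof. by move=> kx; apply/asboolP; exists k. Qed.

Lemma sparse_even x : sparse x -> exists y, x = (2 * y)%R.
Proof. by move=> /asboolP[k /level_even]. Qed.

(** Below 8^(k+1) the set lies in [0, 8^k), {2 * 8^k} and [4 * 8^k, 5 * 8^k). *)
Lemma sparse_isolated k i : (`|i| < 8 ^ k)%N ->
  sparse (2 * pow8 k + i)%R = (i == 0%R).
Proof.
move=> ik; apply/idP/eqP => [h|->]; last first.
  by apply: (@level_sparse k.+1) => /=; apply/or3P/Or33; lia.
have /= : level k.+1 (2 * pow8 k + i)%R.
  by apply: sparse_level h _; rewrite expnS; lia.
case/or3P=> [/level_bound|/level_bound|/eqP]; lia.
Qed.

(** Within distance 8^k of 4 * 8^k the set consists of the translated copy of [level k] only. *)
Lemma sparse_recurrent k y : (`|y| < 8 ^ k)%N ->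
  sparse (y + 4 * pow8 k)%R = sparse y.
Proof.
move=> yk; apply/idP/idP => h.
  have /= : level k.+1 (y + 4 * pow8 k)%R.
    by apply: sparse_level h _; rewrite expnS; lia.
  case/or3P=> [/level_bound|ky|/eqP]; [lia| |lia].
  by apply: (@level_sparse k); move: ky; congr level; lia.
apply: (@level_sparse k.+1) => /=; apply/or3P/Or32.
have : level k y by apply: sparse_level h _; lia.
congr level; lia.
Qed.

(** True of [level k.+1]; all later levels translate by, or add, multiples of 8^(k+1). *)
Lemma sparse_gap k x : sparse x ->
  exists q r : int, x = (q * pow8 k.+1 + r)%R /\ (0 <= r < 5 * pow8 k)%R.
Proof.
case/asboolP=> j jx.
have {jx} : level (j + k.+1) x by apply: level_leq jx; rewrite leq_addr.
elim: j x => [|j IH] x; last first.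
  rewrite addSn; case/or3P=> [/IH//|/IH[q [r [e r5]]]|/eqP ->].
    exists (q + 4 * pow8 j)%R, r; split=> //; move: e; rewrite expnD; lia.
  by exists (2 * pow8 j)%R, 0%R; split; [rewrite expnD|]; lia.
move=> /= h; exists 0%R, x; split; first by lia.
by case/or3P: h => [/level_bound|/level_bound|/eqP]; lia.
Qed.

(** * The group *)

Definition shift (n : int) : bijection int :=
  Bijection (fun x => GRing.addrK n x) (fun x => GRing.subrK n x).

Lemma shiftE n x : shift n x = (x + n)%R. Proof. by []. Qed.

Definition flip_fun (x : int) : int :=
  if sparse x then (x + 1)%R else if sparse (x - 1)%R then (x - 1)%R else x.

(** Evenness keeps the pairs {s, s+1} disjoint, which makes [flip_fun] an involution. *)
Lemma sparse_succ x : sparse x -> sparse (x + 1)%R = false.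
Proof. by move=> /sparse_even[y e]; apply/negP => /sparse_even[z e']; lia. Qed.

Lemma flip_funK : involutive flip_fun.
Proof.
move=> x; rewrite /flip_fun; case sx: (sparse x).
  by rewrite sparse_succ // GRing.addrK sx.
by case sx1: (sparse (x - 1)%R); rewrite ?sx1 ?GRing.subrK ?sx.
Qed.

Definition flip : bijection int := Bijection flip_funK flip_funK.

Definition gens : set (bijection int) := [set flip; shift 1].
Definition flip_shift_group : groupType := sgrp (generated_subgroupP gens).

Lemma generated_shift n : generated_subgroup gens (shift n).
Proof.
have gP := generated_subgroupP gens.
have g1 : generated_subgroup gens (shift 1) by apply: sub_gen_smallest; right.
have gn (m : nat) : generated_subgroup gens (shift m).
  elim: m => [|m IH].
    have -> : shift 0 = 1 by apply: bijP => x; rewrite shiftE bij1; lia.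
    by case: gP.
  have -> : shift m.+1 = shift m * shift 1.
    by apply: bijP => x; rewrite bijM !shiftE; lia.
  exact: (subgroup_setM gP).
have [n0|n0] : n = Posz `|n| \/ n = (- Posz `|n|)%R by lia.
  by rewrite n0.
rewrite n0; have -> : shift (- Posz `|n|)%R = (shift `|n|%N)^-1. by exact: bijP.
exact: (subgroup_setV gP).
Qed.

(** * High transitivity and infinite supports of the group *)

Lemma flip_shift_highly_transitive :
  highly_transitive (@sgrp_val _ _ (generated_subgroupP gens)).
Proof.
have gP := generated_subgroupP gens.
apply: approx_swap_highly_transitive => x L.
(* Moved by [s - x], the window of radius [L] lands where [s] is isolated. The summand 1 covers the
   left neighbour that [flip_fun] inspects. *)
pose k := (`|x| + L + 1)%N; pose s : int := (2 * pow8 k)%R.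
exists (shift (x - s)%R * flip * shift (s - x)%R).
  have gf : generated_subgroup gens flip by apply: sub_gen_smallest; left.
  apply: (subgroup_setM gP) (generated_shift _).
  exact: (subgroup_setM gP) (generated_shift _) gf.
move=> y yL; rewrite !bijM !shiftE.
have k8 : (k < 8 ^ k)%N by rewrite ltn_expl.
have isol i : (`|i| <= k)%N -> sparse (s + i)%R = (i == 0%R).
  by move=> ik; apply: sparse_isolated; lia.
rewrite [flip _]/(flip_fun _) /flip_fun /swap.
have -> : (y + (s - x) = s + (y - x))%R by lia.
have -> : (s + (y - x) - 1 = s + (y - x - 1))%R by lia.
have e0 : sparse (s + (y - x))%R = (y == x) by rewrite isol; lia.
have e1 : y != x -> sparse (s + (y - x - 1))%R = (y == (x + 1)%R).
  by move=> yx; rewrite isol; lia.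
rewrite e0; case: (y =P x) e1 => [yx _|yx ->//]; first by lia.
by case: eqP; lia.
Qed.

(** The threshold depends on [x], since [sparse_recurrent] reaches only points of absolute value
    below 8^k. *)
Definition eventually_equivariant : set (bijection int) :=
  [set f | forall x, exists k0, forall k, (k0 <= k)%N ->
    f (x + 4 * pow8 k)%R = (f x + 4 * pow8 k)%R].

Lemma eventually_equivariantP : subgroup_set eventually_equivariant.
Proof.
split=> [x|f g ef eg x]; first by exists 0%N.
have [k1 h1] := eg (g^-1 x); have [k2 h2] := ef (g^-1 x).
exists (maxn k1 k2) => k; rewrite geq_max => /andP[/h1 e1 /h2 e2].
rewrite !bijM -e2; congr (f _).
by apply: (@bij_injective _ g); rewrite e1 !bijKV.
Qed.

Lemma gens_eventually_equivariant :
  generated_subgroup gens `<=` eventually_equivariant.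
Proof.
apply: smallest_sub; first exact: eventually_equivariantP.
move=> _ [->|->] x; last first.
  by exists 0%N => k _; rewrite !shiftE; lia.
exists (`|x| + 1)%N => k xk.
change (flip_fun (x + 4 * pow8 k)%R = (flip_fun x + 4 * pow8 k)%R).
have k8 : (k < 8 ^ k)%N by rewrite ltn_expl.
have e1 : (x + 4 * pow8 k - 1 = x - 1 + 4 * pow8 k)%R by lia.
rewrite /flip_fun e1 !sparse_recurrent; try lia.
by case: sparse; [lia|case: sparse; lia].
Qed.

Lemma flip_shift_infinite_supports :
  infinite_supports (@sgrp_val _ _ (generated_subgroupP gens)).
Proof.
move=> g g1 s; have [x gx] : exists x, sgrp_val g x <> x.
  apply: contrapT => /forallNP h; apply: g1; apply: sgrp_val_inj.
  by apply: bijP => x; rewrite gmulf1; apply: contrapT; exact: h.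
have [k0 gk] := gens_eventually_equivariant (sgrp_valP g) x.
have [L sL] := absz_bounded s.
(* Large enough for equivariance at [x] and for the translate to leave [-L, L]. *)
pose k := (k0 + L + `|x|)%N; have k8 : (k < 8 ^ k)%N by rewrite ltn_expl.
exists (x + 4 * pow8 k)%R; first by apply/negP => /sL; lia.
by rewrite gk; lia.
Qed.

Lemma flip_shift_MIF : mixed_identity_free flip_shift_group.
Proof.
apply: highly_transitive_MIF flip_shift_highly_transitive
  flip_shift_infinite_supports _.
move=> s; have [L sL] := absz_bounded s.
by exists (Posz L.+1); apply/negP => /sL; lia.
Qed.

(** The image in [G] of a subgroup of [sgrp] is a subgroup of [G]; if it contains [A], it contains
    all that [A] generates. *)
Lemma sgrp_generated (G : groupType) (A : set G) :
  generated_subgroup (sgrp_val @^-1` A) =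
  [set: sgrp (generated_subgroupP A)].
Proof.
apply/seteqP; split=> // x _ B [Bsub AB].
suff : generated_subgroup A `<=` sgrp_val @` B.
  by move=> /(_ _ (sgrp_valP x)) [y By /sgrp_val_inj <-].
apply: smallest_sub => [|a Aa].
  case: Bsub => B1 BF; split; first by exists 1; rewrite ?gmulf1.
  by move=> _ _ [y By <-] [z Bz <-]; exists (y / z); rewrite ?gmulfF //;
    apply: BF.
have ga : generated_subgroup A a by exact: sub_gen_smallest.
have yE := sgrp_inK (generated_subgroupP A) ga.
exists (sgrp_in (generated_subgroupP A) ga) => //; apply: AB.
by change (A (sgrp_val (sgrp_in (generated_subgroupP A) ga))); rewrite yE.
Qed.

Lemma flip_shift_two_generated :
  exists a b : flip_shift_group, generated_subgroup [set a; b] = setT.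
Proof.
have ga : generated_subgroup gens flip by apply: sub_gen_smallest; left.
have gb : generated_subgroup gens (shift 1) by apply: sub_gen_smallest; right.
exists (sgrp_in _ ga), (sgrp_in _ gb); rewrite -sgrp_generated.
congr generated_subgroup.
apply/seteqP; split=> [x xab|x]; last first.
  by case=> e; [left|right]; apply: sgrp_val_inj; rewrite sgrp_inK.
suff : gens (sgrp_val x) by [].
by case: xab => ->; rewrite sgrp_inK; [left|right].
Qed.

(** * Cuts *)

Definition cut (m : nat) (c : int) :=
  forall i : int, (`|i| <= m)%N -> sparse (c + i)%R = false.

(** As [f] is bijective, it maps the half-line below a cut [c] onto the one below [c + e]. Thus [e]
    is a translation number: 1 for [shift 1], 0 for [flip]. *)
Definition translates_cuts (e : int) (m : nat) (f : bijection int) :=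
  forall c, cut m c -> forall x, (x < c)%R = (f x < c + e)%R.

Lemma cut_shift m m' c e : (m + `|e| <= m')%N -> cut m' c -> cut m (c + e)%R.
Proof.
move=> mm' cc i im; have -> : (c + e + i = c + (e + i))%R by lia.
by apply: cc; lia.
Qed.

Lemma cut_leq m m' c : (m <= m')%N -> cut m' c -> cut m c.
Proof. by move=> mm' cc i im; apply: cc; lia. Qed.

(** Modulo 8^(m+1) the set avoids the residues from 5 * 8^m on, and 6 * 8^m is more than [m] away
    from both ends of that gap. *)
Lemma cut_periodic m (j : int) : cut m (6 * pow8 m + j * pow8 m.+1)%R.
Proof.
move=> i im; apply/negP => /(@sparse_gap m) [q [r [e r5]]].
have m8 : (m < 8 ^ m)%N by rewrite ltn_expl.
move: e; rewrite expnS; set Q := (8 ^ m)%N in m8 r5 *.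
move: Q m8 r5 => Q m8 r5 e.
have [] : (q <= j \/ j + 1 <= q)%R by lia.
  by nia.
by nia.
Qed.

(** The summand [|e2|] lets [c + e2] still be a cut of radius [m1]. *)
Lemma translates_cutsM e1 m1 f e2 m2 g :
  translates_cuts e1 m1 f -> translates_cuts e2 m2 g ->
  translates_cuts (e2 + e1)%R (m1 + m2 + `|e2|)%N (f * g).
Proof.
move=> hf hg c cc x; rewrite bijM (hg c) ?(hf (c + e2)%R) ?GRing.addrA //.
  by apply: cut_shift cc; lia.
by apply: cut_leq cc; lia.
Qed.

Lemma translates_cutsV e m f :
  translates_cuts e m f -> translates_cuts (- e)%R (m + `|e|)%N f^-1.
Proof.
move=> hf c cc x; rewrite (hf (c - e)%R) ?bijKV ?GRing.subrK //.
by apply: cut_shift cc; lia.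
Qed.

(** A cut for both radii exists, and the image of the half-line below it determines the translation
    number. *)
Lemma translates_cuts_inj e m e' m' f :
  translates_cuts e m f -> translates_cuts e' m' f -> e = e'.
Proof.
move=> h h'; pose c := (6 * pow8 (m + m')%N + 0 * pow8 (m + m')%N.+1)%R.
have cc : cut (m + m') c by exact: cut_periodic.
have c1 : cut m c by apply: cut_leq cc; lia.
have c2 : cut m' c by apply: cut_leq cc; lia.
have E x : (f x < c + e)%R = (f x < c + e')%R by rewrite -(h c c1) -(h' c c2).
have := E (f^-1 (c + e)%R); have := E (f^-1 (c + e')%R); rewrite !bijKV; lia.
Qed.

(** Only a swap of [c - 1] and [c] could cross the cut, and [c - 1] is not in [sparse]. *)
Lemma translates_cuts_flip : translates_cuts 0%R 1 flip.
Proof.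
move=> c cc x; rewrite [flip x]/(flip_fun x) /flip_fun.
have := cc 0%R isT; have := cc (-1)%R isT; rewrite !GRing.addr0 => c1 c0.
case sx: (sparse x).
  have : x != (c - 1)%R by apply: contraTN sx => /eqP ->; rewrite c1.
  by lia.
case sx1: (sparse (x - 1)%R) => //.
have : x != c by apply: contraTN sx1 => /eqP ->; rewrite c1.
by lia.
Qed.

Lemma translates_cuts_shift : translates_cuts 1%R 0 (shift 1%R).
Proof. by move=> c _ x; rewrite shiftE; lia. Qed.

Definition cut_translation : set (bijection int) :=
  [set f | exists e m, translates_cuts e m f].

Lemma cut_translationP : subgroup_set cut_translation.
Proof.
split=> [|f g [e [m hf]] [e' [m' hg]]].
  by exists 0%R, 0%N => c _ x; rewrite GRing.addr0.
by do 2!eexists; apply: (translates_cutsM hf (translates_cutsV hg)).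
Qed.

Definition preserves_cuts m : set (bijection int) :=
  [set f | translates_cuts 0%R m f].

(** For [e = 0] the same cut serves both factors, so the radius does not grow. *)
Lemma preserves_cutsP m : subgroup_set (preserves_cuts m).
Proof.
split=> [c _ x|f g hf hg c cc x]; first by rewrite GRing.addr0.
by rewrite bijM -(hf _ cc) (hg _ cc (g^-1 x)) bijKV GRing.addr0.
Qed.

(** The periodic cuts divide the integers into intervals of length [M], each preserved by the group:
    [pi] is the index of the interval and [lam] the position in it. *)
Lemma EA_preserves_cuts (G : groupType) (rho : {hom G -> bijection int}) m :
  injective rho -> (forall g, preserves_cuts m (rho g)) ->
  elementary_amenable G.
Proof.
move=> rhoI rhoC; pose M := (8 ^ m.+1)%N; pose o : int := (6 * pow8 m)%R.
have M0 : (0 < M)%N by rewrite expn_gt0.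
pose pi (x : int) : int := ((x - o) %/ M)%Z.
(* This is ['I_M], written with a successor as [inord] requires. *)
pose lam (x : int) : 'I_(M.-1).+1 := inord `|((x - o) %% M)%Z|.
have piP (x : int) : (o + pi x * M <= x < o + (pi x + 1) * M)%R.
  by rewrite /pi; have := divz_eq (x - o)%R M; have := @ltz_pmod (x - o)%R M M0;
    have := @modz_ge0 (x - o)%R M; lia.
have lamE (x : int) : nat_of_ord (lam x) = `|((x - o) %% M)%Z|.
  rewrite inordK //; have := @ltz_pmod (x - o)%R M M0.
  by have := @modz_ge0 (x - o)%R M; lia.
apply: (@EA_fiberwise G int int _ rho pi lam rhoI).
  move=> x y exy /(congr1 (@nat_of_ord _)); rewrite !lamE => e.
  have := divz_eq (x - o)%R M; have := divz_eq (y - o)%R M.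
  have := @modz_ge0 (x - o)%R M; have := @modz_ge0 (y - o)%R M.
  by rewrite -!/(pi _) exy; lia.
move=> g x.
have cutP (j : int) : cut m (o + j * M)%R by exact: (@cut_periodic m j).
have := rhoC g _ (cutP (pi x)) x; have := rhoC g _ (cutP (pi x + 1)%R) x.
have := piP x; have := piP (rho g x); rewrite !GRing.addr0.
move: (pi x) (pi (rho g x)) => j j' b b' e e'.
have b1 : (o + j * M <= rho g x < o + (j + 1) * M)%R by lia.
have [//|] : j' = j \/ (j' + 1 <= j \/ j + 1 <= j')%R by lia.
by case; nia.
Qed.

(** * Elementary amenability of the group *)

Definition intgroup := int.

HB.instance Definition _ := Choice.on intgroup.
HB.instance Definition _ := isGroup.Build intgroup
  (@GRing.addrA int) (@GRing.add0r int) (@GRing.addr0 int)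
  (@GRing.addNr int) (@GRing.addrN int).

(** The translation number is a homomorphism onto the integers; its kernel is the union over [m] of
    the groups preserving all cuts of radius [m]. *)
Lemma EA_cut_translation : elementary_amenable (sgrp cut_translationP).
Proof.
pose p (f : sgrp cut_translationP) : intgroup := projT1 (cid (sgrp_valP f)).
have pP f : exists m, translates_cuts (p f) m (sgrp_val f).
  by rewrite /p; case: cid.
have pE f e m : translates_cuts e m (sgrp_val f) -> p f = e.
  by have [m' h] := pP f; exact: translates_cuts_inj h.
have pM : monoid_morphism p.
  split=> [|f g].
    by apply: (pE 1 0%R 0%N) => c _ x; rewrite gmulf1 GRing.addr0.
  have [m h] := pP f; have [m' h'] := pP g; apply: pE.
  rewrite gmulfM -[_ * _]/(GRing.add _ _) GRing.addrC.
  exact: translates_cutsM h h'.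
pose pm := isUMagmaMorphism.Build _ _ p pM.
pose phi : {hom sgrp cut_translationP -> intgroup} := HB.pack p pm.
pose K := [set f | phi f = 1].
have KP : subgroup_set K.
  split=> [|x y x1 y1]; first by rewrite /K /mkset gmulf1.
  by rewrite /K /mkset gmulfF x1 y1 divg1.
apply: (@EAExt (sgrp KP) _ _ sgrp_val phi).
- exact: sgrp_val_inj.
- move=> e; have se : cut_translation (shift e).
    by exists e, 0%N => c _ x; rewrite shiftE; lia.
  exists (sgrp_in _ se); apply: (pE _ e 0%N) => c _ x.
  by rewrite sgrp_inK shiftE; lia.
- move=> x; rewrite -[phi x = 1]/(K x) -sgrp_range.
  by split=> [[y _ <-]|[y <-]]; exists y.
- pose P m := [set f : sgrp KP | preserves_cuts m (sgrp_val (sgrp_val f))].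
  have PP m : subgroup_set (P m).
    have [P1 PF] := preserves_cutsP m; split.
      by rewrite /P /mkset !gmulf1.
    by move=> f g hf hg; rewrite /P /mkset !gmulfF; apply: PF.
  apply: (EA_directed_sets (gP := PP)).
  (* A larger radius leaves fewer cuts to preserve. *)
  + move=> i j; exists (maxn i j); split=> f h c cc; apply: h;
      by apply: cut_leq cc; lia.
  + move=> f; have [m h] := pP (sgrp_val f); exists m; move: h.
    by have -> : p (sgrp_val f) = 0%R by exact: (sgrp_valP f).
  + move=> m; apply: (@EA_preserves_cuts _
        (sgrp_val \o (sgrp_val \o sgrp_val)) m).
      by do 2?[apply: inj_comp]; exact: sgrp_val_inj.
    by move=> g; exact: (sgrp_valP g).
- by apply: EAAbelian => x y; exact: GRing.addrC.
Qed.

Lemma gens_cut_translation : generated_subgroup gens `<=` cut_translation.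
Proof.
apply: smallest_sub; first exact: cut_translationP.
move=> _ [->|->].
  by exists 0%R, 1%N; exact: translates_cuts_flip.
by exists 1%R, 0%N; exact: translates_cuts_shift.
Qed.

Lemma EA_flip_shift_group : elementary_amenable flip_shift_group.
Proof.
have [f fE] := @sgrp_hom _ _ _ (generated_subgroupP gens) _ cut_translationP
  (idfun : {hom bijection int -> bijection int}) gens_cut_translation.
apply: (EASub (f := f)) EA_cut_translation.
by move=> x y e; apply: sgrp_val_inj; move: (fE x) (fE y); rewrite e => -> /=.
Qed.

Theorem theorem1p2 :
  exists G : groupType,
    [/\ exists a b : G, generated_subgroup [set a; b] = setT,
        elementary_amenable G &
        mixed_identity_free G].
Proof.
exists flip_shift_group; split.
- exact: flip_shift_two_generated.
- exact: EA_flip_shift_group.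
- exact: flip_shift_MIF.
Qed.
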